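(* Let $\leadsto$ be a Noetherian relation on a type $A$. Then the relation $\leadsto^{+\circ+}$ on the type of cycles of $\leadsto$ is Noetherian.
   Context: Homotopy type theory setting; relations are arbitrary type families $A\to A\to\mathcal U$. Accessibility: $\mathsf{acc}^<$ is inductively generated by $\mathsf{step}:(\Pi x.(x<a)\to\mathsf{acc}^<(x))\to\mathsf{acc}^<(a)$; $<$ is well-founded if every element is accessible; a relation is Noetherian if its opposite is well-founded. Closures: $\leadsto^+$ is the transitive closure (inductive with constructors $(a\leadsto b)\to(a\leadsto^+b)$ and $(a\leadsto^+b)\to(b\leadsto c)\to(a\leadsto^+c)$); $\leadsto^*$ reflexive-transitive closure; $(a\leadsto^sb):=(a\leadsto b)+(b\leadsto a)$; $\leadsto^{s*}:=(\leadsto^s)^*$. A cycle is an element of $\Sigma(a:A).(a\leadsto^{s*}a)$. The vertex list $\pi(\gamma)\in\mathsf{List}\,A$ of a chain is defined by $\pi(\mathsf{nil})=\mathsf{nil}$ and $\pi(\mathsf{snoc}(\alpha,p))=\pi(\alpha)::c$ where $c$ is the endpoint of segment $p$ (so the initial vertex is omitted). $\mathsf{rot}$ on lists moves the first element (if any) to the end; on cycles it moves the first segment to the end, commuting with $\pi$. For a relation $R$ on $A$ and lists $k,l$, write $k\triangleright_R l$ if $l$ is obtained from $k$ by replacing a single element $x$ of $k$ by a finite list of elements $y$ each satisfying $x\mathrel{R}y$. For cycles $\gamma,\delta$, set $\gamma\mathrel{R^{\circ}}\delta$ iff there is $n:\mathbb N$ with $\pi(\gamma)\triangleright_R\mathsf{rot}^n(\pi(\delta))$.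 Then $\leadsto^{+\circ+}$ is the transitive closure of $(\leadsto^+)^{\circ}$. (This is the list/multiset-style extension oriented along $\leadsto$, so that $\delta$ is ''smaller'' than $\gamma$.) *)

(* Defs.v *)
(* Relations, accessibility and all connectives are valued in
   [Type] (no truncation), so [Acc], [well_founded], [clos_trans] and [Forall],
   which are [Prop]-valued, do not apply. *)
From Stdlib Require Import List CRelationClasses.
Import ListNotations.

Inductive acc {A : Type} (R : crelation A) (a : A) : Type :=
| acc_step : (forall x, R x a -> acc R x) -> acc R a.

Definition wellfounded {A : Type} (R : crelation A) : Type :=
  forall a, acc R a.

Definition noetherian {A : Type} (R : crelation A) : Type :=
  wellfounded (fun a b => R b a).

Inductive trans_clos {A : Type} (R : crelation A) (a : A) : A -> Type :=
| tc_step : forall b, R a b -> trans_clos R a b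
| tc_snoc : forall b c, trans_clos R a b -> R b c -> trans_clos R a c.

Inductive refl_trans_clos {A : Type} (R : crelation A) (a : A) : A -> Type :=
| rtc_nil : refl_trans_clos R a a
| rtc_snoc : forall b c,
    refl_trans_clos R a b -> R b c -> refl_trans_clos R a c.

Definition sym_clos {A : Type} (R : crelation A) : crelation A :=
  fun a b => (R a b + R b a)%type.

Definition cycle {A : Type} (R : crelation A) : Type :=
  {a : A & refl_trans_clos (sym_clos R) a a}.

(* The initial vertex [a] is omitted and the endpoint is included, so a cycle
   with n segments has exactly n listed vertices. *)
Fixpoint chain_vertices {A : Type} {R : crelation A} {a b : A}
    (p : refl_trans_clos R a b) : list A :=
  match p with
  | rtc_nil _ _ => []
  | rtc_snoc _ _ _ c q _ => chain_vertices q ++ [c]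
  end.

Definition vertices {A : Type} {R : crelation A} (g : cycle R) : list A :=
  chain_vertices (projT2 g).

Definition rot {A : Type} (l : list A) : list A :=
  match l with
  | [] => []
  | x :: l' => l' ++ [x]
  end.

Inductive all_list {A : Type} (P : A -> Type) : list A -> Type :=
| all_nil : all_list P []
| all_cons : forall x l, P x -> all_list P l -> all_list P (x :: l).

(* [ys] may be empty: an element may simply be deleted. *)
Inductive list_ext {A : Type} (R : crelation A) : crelation (list A) :=
| list_ext_replace : forall (pre suf : list A) (x : A) (ys : list A),
    all_list (R x) ys -> list_ext R (pre ++ x :: suf) (pre ++ ys ++ suf).

(* [R] is the relation whose cycles are compared, [S] the relation on vertices
   being extended. *)
Definition cycle_ext {A : Type} (R S : crelation A) : crelation (cycle R) :=
  fun g d =>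
    {n : nat & list_ext S (vertices g) (Nat.iter n rot (vertices d))}.

(* Main.v *)
(** Call a list accessible when it is accessible for [list_ext S], oriented so
    that the replaced list is smaller. A replacement in [k ++ l] happens
    entirely in [k] or entirely in [l], so concatenation preserves
    accessibility; hence every list is accessible once singletons are, and
    these are handled by Noetherian induction on [S]. Rotating a list before a
    replacement amounts to rotating the result of a replacement, so the
    statement carries over to cycles by induction on the accessibility of some
    rotation of the vertex list. *)
Require Import Defs.
From Stdlib Require Import CRelationClasses List PeanoNat.
Import ListNotations.

Section TransitiveClosure.

Context {A : Type} (R : crelation A).

(** A single step out of [a] is covered by the induction hypothesis. A longer path ends with one
    step from a point already shown accessible for the closure. *)
Lemma acc_trans_clos (a : A) :
  acc (fun x y => R y x) a -> acc (fun x y => trans_clos R y x) a.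
Proof.
  induction 1 as [a _ IH]; constructor; intros x Hax.
  induction Hax as [b Hab | b c _ [Hb] Hbc].
  - exact (IH b Hab).
  - exact (Hb c (tc_step R b c Hbc)).
Qed.

Lemma noetherian_trans_clos : noetherian R -> noetherian (trans_clos R).
Proof. intros hR a; exact (acc_trans_clos a (hR a)). Qed.

End TransitiveClosure.

Section ListExtension.

Context {A : Type} (S : crelation A).

Lemma app_eq_app_cons_split (pre k l suf : list A) (x : A) :
  pre ++ x :: suf = k ++ l ->
  ({suf' & ((k = pre ++ x :: suf') * (suf = suf' ++ l))%type}
   + {pre' & ((pre = k ++ pre') * (l = pre' ++ x :: suf))%type})%type.
Proof.
  revert k; induction pre as [|a pre IH]; intros [|b k]; simpl; intros E.
  - right; exists []; split; [reflexivity | exact (eq_sym E)].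
  - injection E as -> ->; left; exists k; split; reflexivity.
  - right; exists (a :: pre); split; [reflexivity | exact (eq_sym E)].
  - injection E as -> E.
    destruct (IH k E) as [[suf' [-> ->]] | [pre' [-> ->]]].
    + left; exists suf'; split; reflexivity.
    + right; exists pre'; split; reflexivity.
Qed.

Lemma list_ext_app_inv (k l m : list A) :
  list_ext S (k ++ l) m ->
  ({k' & (list_ext S k k' * (m = k' ++ l))%type}
   + {l' & (list_ext S l l' * (m = k ++ l'))%type})%type.
Proof.
  intros H; remember (k ++ l) as kl eqn:E.
  destruct H as [pre suf x ys Hys].
  destruct (app_eq_app_cons_split _ _ _ _ _ E)
    as [[suf' [-> ->]] | [pre' [-> ->]]].
  - left; exists (pre ++ ys ++ suf'); split.
    + constructor; exact Hys.
    + rewrite <- !app_assoc; reflexivity.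
  - right; exists (pre' ++ ys ++ suf); split.
    + constructor; exact Hys.
    + rewrite <- app_assoc; reflexivity.
Qed.

Lemma list_ext_nil_inv (m : list A) : list_ext S [] m -> False.
Proof.
  intros H; remember [] as k eqn:E; destruct H as [[|] suf x ys _];
    discriminate E.
Qed.

Lemma list_ext_singleton_inv (x : A) (m : list A) :
  list_ext S [x] m -> all_list (S x) m.
Proof.
  intros H; remember [x] as k eqn:E; destruct H as [[|a [|]] suf y ys Hys];
    try discriminate E.
  injection E as -> ->; simpl; rewrite app_nil_r; exact Hys.
Qed.

Lemma acc_list_ext_nil : acc (fun l k => list_ext S k l) [].
Proof. constructor; intros m Hm; destruct (list_ext_nil_inv m Hm). Qed.

(** Nested induction, on [k] outside and on [l] inside: a replacement in one part keeps the other,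
    so one of the two accessibility proofs always descends. *)
Lemma acc_list_ext_app (k l : list A) :
  acc (fun l k => list_ext S k l) k -> acc (fun l k => list_ext S k l) l ->
  acc (fun l k => list_ext S k l) (k ++ l).
Proof.
  intros Hk; revert l; induction Hk as [k _ IHk]; intros l Hl.
  induction Hl as [l Hl IHl]; constructor; intros m Hm.
  destruct (list_ext_app_inv k l m Hm) as [[k' [Hk' ->]] | [l' [Hl' ->]]].
  - apply IHk; [exact Hk' | constructor; exact Hl].
  - exact (IHl l' Hl').
Qed.

Lemma acc_list_ext_singleton (x : A) :
  acc (fun a b => S b a) x -> acc (fun l k => list_ext S k l) [x].
Proof.
  induction 1 as [x _ IH]; constructor; intros m Hm.
  induction (list_ext_singleton_inv x m Hm) as [|y ys Hy Hys IHys].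
  - exact acc_list_ext_nil.
  - apply (acc_list_ext_app [y] ys); [exact (IH y Hy) | apply IHys].
    (* The inner induction generalizes [Hm], so [IHys] asks for [ys] itself to be a replacement of
       [[x]]. *)
    pose proof (list_ext_replace S [] [] x ys Hys) as H; simpl in H.
    rewrite app_nil_r in H; exact H.
Qed.

Lemma noetherian_list_ext : noetherian S -> noetherian (list_ext S).
Proof.
  intros hS l; induction l as [|x l IH].
  - exact acc_list_ext_nil.
  - exact (acc_list_ext_app [x] l (acc_list_ext_singleton x (hS x)) IH).
Qed.

Lemma iter_rot_app (k l : list A) :
  Nat.iter (length k) rot (k ++ l) = l ++ k.
Proof.
  revert l; induction k as [|a k IH]; intros l.
  - simpl; rewrite app_nil_r; reflexivity.
  - change (length (a :: k)) with (1 + length k).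
    rewrite Nat.add_comm, Nat.iter_add; simpl.
    rewrite <- app_assoc, IH, <- app_assoc; reflexivity.
Qed.

(* Rotating away the replaced element rotates away all its replacements, so
   the number of rotations on the right is not 1 in general. *)
Lemma list_ext_rot (k l : list A) :
  list_ext S k l -> {j & list_ext S (rot k) (Nat.iter j rot l)}.
Proof.
  intros [[|a pre] suf x ys Hys]; simpl.
  - exists (length ys); rewrite iter_rot_app.
    pose proof (list_ext_replace S suf [] x ys Hys) as H.
    rewrite app_nil_r in H; exact H.
  - exists 1; simpl; rewrite <- !app_assoc; simpl; constructor; exact Hys.
Qed.

Lemma list_ext_iter_rot (n : nat) (k l : list A) :
  list_ext S k l ->
  {j & list_ext S (Nat.iter n rot k) (Nat.iter j rot l)}.
Proof.
  intros H; induction n as [|n [j Hj]].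
  - exists 0; exact H.
  - destruct (list_ext_rot _ _ Hj) as [i Hi].
    exists (i + j); rewrite Nat.iter_add; exact Hi.
Qed.

End ListExtension.

(** A step to [d] yields a smaller list that is only some rotation of [vertices d], so [g] and [n]
    must stay general in the induction. *)
Lemma acc_cycle_ext {A : Type} (R S : crelation A) (l : list A) :
  acc (fun l k => list_ext S k l) l ->
  forall (g : cycle R) (n : nat), Nat.iter n rot (vertices g) = l ->
  acc (fun d g => cycle_ext R S g d) g.
Proof.
  induction 1 as [l _ IH]; intros g n <-; constructor; intros d [m Hm].
  destruct (list_ext_iter_rot S n _ _ Hm) as [j Hj].
  apply (IH _ Hj d (j + m)); apply Nat.iter_add.
Qed.

Lemma noetherian_cycle_ext {A : Type} (R S : crelation A) :
  noetherian S -> noetherian (cycle_ext R S).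
Proof.
  intros hS g.
  exact (acc_cycle_ext R S _ (noetherian_list_ext S hS (vertices g)) g 0 eq_refl).
Qed.

Theorem theorem5p12 (A : Type) (R : crelation A) (hR : noetherian R) :
  noetherian (trans_clos (cycle_ext R (trans_clos R))).
Proof.
  (* The first closure is the one on cycles, the last the one of [R] on vertices. *)
  apply noetherian_trans_clos, noetherian_cycle_ext, noetherian_trans_clos.
  exact hR.
Qed.
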